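(* Let $G$ be a group, $F=(F_N)_{N\in\mathbb{N}}$ a sequence of finite, nonempty subsets of $G$, $(X,\mathcal{B},\mu,(T_g)_{g\in G})$ a measure preserving system, $Y\in\mathcal{B}$ and $\varepsilon>0$. Then there exist $h\in G$ and $B\subseteq G$ such that $\overline{d}_F(B)\geq\mu(Y)^2-\varepsilon$ and $$h^2BB\subseteq\{g\in G:\mu(Y\cap T_gY)>0\}.$$
   Context: A measure preserving system $(X,\mathcal{B},\mu,(T_g)_{g\in G})$ consists of a probability space $(X,\mathcal{B},\mu)$ and a left action $(T_g)_{g\in G}$ of $G$ on $X$ by measure-preserving maps, so that $T_{gh}=T_g\circ T_h$. For $E\subseteq G$, $\overline{d}_F(E)=\limsup_{N\to\infty}\frac{|E\cap F_N|}{|F_N|}$. $h^2BB=\{h^2bb':b,b'\in B\}$. *)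

(* Defs.v *)
From mathcomp Require Export all_boot all_order all_algebra finmap.
From mathcomp Require Export all_classical all_reals all_analysis.

Set Implicit Arguments.
Unset Strict Implicit.
Unset Printing Implicit Defensive.

Import Order.TTheory GRing.Theory Num.Theory.
Import numFieldNormedType.Exports.

Local Open Scope classical_set_scope.
Local Open Scope ring_scope.

Definition measure_preserving (R : realType) (d : measure_display)
    (X : measurableType d) (mu : probability X R) (f : X -> X) : Prop :=
  measurable_fun [set: X] f /\
  forall A : set X, measurable A -> mu (f @^-1` A) = mu A.

Definition is_left_action (G : groupType) (X : Type) (T : G -> X -> X) : Prop :=
  T 1%g = id /\ forall g h : G, T (g * h)%g = T g \o T h.

Definition measure_preserving_system (G : groupType) (R : realType)
    (d : measure_display) (X : measurableType d) (mu : probability X R)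
    (T : G -> X -> X) : Prop :=
  is_left_action T /\ forall g : G, measure_preserving mu (T g).

(* The ratios lie in [0, 1], so the real-valued limsup [limn_sup] is the
   actual one. *)
Definition upper_density (R : realType) (G : groupType)
    (F : nat -> {fset G}) (E : set G) : R :=
  limn_sup (fun N : nat =>
    #|` [fset g in F N | g \in E]%fset |%:R / #|` F N |%:R : R).

Definition sq_shift_product (G : groupType) (h : G) (B : set G) : set G :=
  [set (h ^+ 2 * b * b')%g | b in B & b' in B].

(* [T g @` Y] is measurable, being the preimage of [Y] under [T g^-1]. *)
Definition positive_return_set (G : groupType) (R : realType)
    (d : measure_display) (X : measurableType d) (mu : probability X R)
    (T : G -> X -> X) (Y : set X) : set G :=
  [set g | (0 < mu (Y `&` (T g @` Y)))%E].

(* Main.v *)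
Require Import Defs.
From mathcomp Require Import measurable_realfun ring lra.

Import Order.TTheory GRing.Theory Num.Theory.
Import numFieldNormedType.Exports.

Local Open Scope classical_set_scope.
Local Open Scope ring_scope.

(** Write [S g] for the preimage of [Y] under [T g], that is [T g^-1 @` Y].
    Invariance of [mu] says that [mu (S a `&` S b)] does not change when [a]
    and [b] are multiplied on the right by the same [g], and [g] is a return
    time of [Y] with positive measure exactly when [S g `&` S 1] is not null.
    Put [A b := S (h^2 b) `&` S b^-1]. If [A b `&` A b'] is not null, then
    neither is [S (h^2 b) `&` S b'^-1], and [h^2 b b'] is such a return time.
    So it is enough to find [h] and a set [B] of large upper density such that
    the sets [A b], [b \in B], meet pairwise in positive measure.

    The choice of [h] is a Hilbert space argument. Put [V b := S (b^-2)]. If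
    [h = b0^-1], then [mu (A b) = mu (V b0 `&` V b)] by invariance. Let [f N] be
    the average of the indicators of [V b] over [b \in F N]; these functions
    have values in [0, 1] and the same mean [m = mu Y]. If for each [n] the
    inner product of [f n] and [f N] were eventually at most [c < m ^+ 2], one
    could greedily pick [k] of them with all inner products at most [c]; their
    sum has mean [k * m] and squared norm at most [k + k ^+ 2 * c], against the
    Cauchy-Schwarz inequality for large [k] (lemma [recurrent_correlation]).
    So some [f n] has correlation more than [c] with [f N] for infinitely many
    [N], and since [f n] is an average over the finite set [F n], one [b0] in
    [F n] does as well as [f n] (lemma [recurrent_intersection]).

    With this [h], the average of [mu (A b)] over [F N] exceeds [c] infinitely
    often. By a reverse Fatou argument, a set of points [x] of positive measure
    lies in nearly that proportion of the sets [A b], [b \in F N], for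
    infinitely many [N] (lemma [lim_sup_superlevel_gt0]). The union of the
    [F N] is countable, so [x] may also be chosen outside all null sets of the
    form [A b `&` A b']; then [B], the set of the [b] such that [x] is in [A b],
    has the two required properties (lemma [dense_positive_intersections]). *)

(** * Means of bounded measurable functions *)

Section BoundedMeasurable.
Local Set Implicit Arguments.
Local Unset Strict Implicit.
Context (R : realType) (d : measure_display) (X : measurableType d).
Context (mu : probability X R).
Implicit Types (f g : X -> R).

Definition bounded_measurable f :=
  measurable_fun [set: X] f /\ exists M : R, forall x, `|f x| <= M.

Lemma bounded_measurable_cst r : bounded_measurable (fun=> r).
Proof. by split => //; exists `|r|. Qed.

Lemma bounded_measurableD f g :
  bounded_measurable f -> bounded_measurable g ->
  bounded_measurable (fun x => f x + g x).
Proof.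
move=> [mf [M fM]] [mg [N gN]]; split; first exact: measurable_funD.
by exists (M + N) => x; rewrite (le_trans (ler_normD _ _))// lerD.
Qed.

Lemma bounded_measurableM f g :
  bounded_measurable f -> bounded_measurable g ->
  bounded_measurable (fun x => f x * g x).
Proof.
move=> [mf [M fM]] [mg [N gN]]; split; first exact: measurable_funM.
by exists (M * N) => x; rewrite normrM ler_pM.
Qed.

Lemma bounded_measurable_indic (A : set X) :
  measurable A -> bounded_measurable (\1_A).
Proof.
move=> mA; split; first exact: measurable_indic.
by exists 1 => x; rewrite indicE; case: (x \in A); rewrite ?normr1 ?normr0.
Qed.

Lemma bounded_measurable_unit f : measurable_fun [set: X] f ->
  (forall x, 0 <= f x <= 1) -> bounded_measurable f.
Proof.
move=> mf f01; split => //; exists 1 => x.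
by have /andP[f0 f1] := f01 x; rewrite ger0_norm.
Qed.

Lemma bounded_measurable_sum (I : Type) (s : seq I) (f : I -> X -> R) :
  (forall i, bounded_measurable (f i)) ->
  bounded_measurable (fun x => \sum_(i <- s) f i x).
Proof.
move=> bf; elim: s => [|i s ih].
  have -> : (fun x => \sum_(i <- [::]) f i x) = (fun=> 0).
    by apply/funext => x; rewrite big_nil.
  exact: bounded_measurable_cst.
have -> : (fun x => \sum_(j <- i :: s) f j x) =
    (fun x => f i x + \sum_(j <- s) f j x).
  by apply/funext => x; rewrite big_cons.
exact: bounded_measurableD.
Qed.

Lemma bounded_measurable_integrable f :
  bounded_measurable f -> mu.-integrable [set: X] (EFin \o f).
Proof.
move=> [mf [M fM]]; apply: measurable_bounded_integrable => //.
  exact: (le_lt_trans (probability_le1 mu measurableT) (ltry 1)).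
exists M; split; first by rewrite num_real.
by move=> y My x _ /=; rewrite (le_trans (fM x))// ltW.
Qed.

Lemma mean_cst r : \int[mu]_x (fun=> r) x = r.
Proof.
rewrite Rintegral_cst//.
have -> : fine (mu [set: X]) = 1 by have -> := probability_setT mu.
by rewrite mulr1.
Qed.

Lemma mean_indic (A : set X) : measurable A ->
  \int[mu]_x \1_A x = fine (mu A).
Proof. by move=> mA; rewrite /Rintegral integral_indic// setIT. Qed.

Lemma meanD f g : bounded_measurable f -> bounded_measurable g ->
  \int[mu]_x (f x + g x) = \int[mu]_x f x + \int[mu]_x g x.
Proof.
by move=> bf bg; rewrite RintegralD//; exact: bounded_measurable_integrable.
Qed.

Lemma meanZ r f : bounded_measurable f ->
  \int[mu]_x (r * f x) = r * \int[mu]_x f x.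
Proof.
by move=> bf; rewrite RintegralZl//; exact: bounded_measurable_integrable.
Qed.

Lemma mean_sum (I : Type) (s : seq I) (f : I -> X -> R) :
  (forall i, bounded_measurable (f i)) ->
  \int[mu]_x (\sum_(i <- s) f i x) = \sum_(i <- s) \int[mu]_x f i x.
Proof.
move=> bf; elim: s => [|i s ih].
  under eq_Rintegral do rewrite big_nil.
  by rewrite big_nil mean_cst.
under eq_Rintegral do rewrite big_cons.
by rewrite big_cons meanD ?ih//; exact: bounded_measurable_sum.
Qed.

Lemma le_mean f g : bounded_measurable f -> bounded_measurable g ->
  (forall x, f x <= g x) -> \int[mu]_x f x <= \int[mu]_x g x.
Proof.
by move=> bf bg fg; apply: le_Rintegral => //;
  exact: bounded_measurable_integrable.
Qed.

(** The instance of the Cauchy-Schwarz inequality used below: integrate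
    [2 * m * f x <= f x ^+ 2 + m ^+ 2], where [m] is the mean of [f]. *)
Lemma mean_sqr_le f : bounded_measurable f ->
  (\int[mu]_x f x) ^+ 2 <= \int[mu]_x (f x * f x).
Proof.
move=> bf; set m := \int[mu]_x f x.
have bcf : bounded_measurable (fun x => (2 * m) * f x).
  by apply: bounded_measurableM => //; exact: bounded_measurable_cst.
have bff : bounded_measurable (fun x => f x * f x + m ^+ 2).
  by apply: bounded_measurableD;
    [exact: bounded_measurableM|exact: bounded_measurable_cst].
have := le_mean bcf bff; rewrite meanZ// meanD;
  [|exact: bounded_measurableM|exact: bounded_measurable_cst].
rewrite mean_cst -/m => /(_ _)/wrap[x|].
  by have := sqr_ge0 (f x - m); nra.
by rewrite expr2; nra.
Qed.

(** * Recurrent correlations and limsup of superlevel sets *)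

(** Vectors of norm at most 1 whose pairwise inner products are at most [c]
    have a sum of squared norm about [k ^+ 2 * c] at most, while the mean of
    that sum forces [k ^+ 2 * m ^+ 2] at least. Choosing the vectors one at a
    time only requires that inner products with each fixed [f n] be eventually
    at most [c], so this cannot hold for every [n]. *)
Lemma recurrent_correlation (f : nat -> X -> R) (m c : R) :
  (forall n, measurable_fun [set: X] (f n)) ->
  (forall n x, 0 <= f n x <= 1) ->
  (forall n, \int[mu]_x f n x = m) ->
  0 <= c -> c < m ^+ 2 ->
  exists n, forall k,
    exists2 N, (k <= N)%N & c < \int[mu]_x (f n x * f N x).
Proof.
move=> mf f01 fm c0 cm; apply: contrapT => /forallNP H.
have {}H n : exists k, forall N, (k <= N)%N ->
    \int[mu]_x (f n x * f N x) <= c.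
  have /existsNP[k Hk] := H n; exists k => N kN.
  by rewrite leNgt; apply/negP => cN; apply: Hk; exists N.
have bf n : bounded_measurable (f n) by exact: bounded_measurable_unit.
have bff n : bounded_measurable (fun x => f n x * f n x).
  exact: bounded_measurableM.
(* [g] is the sum of the [k] functions picked so far; the last clause allows
   the next one to be picked. *)
have P k : exists g, [/\ bounded_measurable g, \int[mu]_x g x = k%:R * m,
    \int[mu]_x (g x * g x) <= k%:R + k%:R ^+ 2 * c &
    exists M, forall N, (M <= N)%N -> \int[mu]_x (g x * f N x) <= k%:R * c].
  elim: k => [|k [g [bg gm gg [M gM]]]].
    exists (fun=> 0); split; first exact: bounded_measurable_cst.
    - by rewrite mean_cst mul0r.
    - under eq_Rintegral do rewrite mul0r.
      by rewrite mean_cst expr0n /= mul0r addr0.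
    - exists 0%N => N _; under eq_Rintegral do rewrite mul0r.
      by rewrite mean_cst mul0r.
  have [M' fM'] := H M.
  have bgf N : bounded_measurable (fun x => g x * f N x).
    exact: bounded_measurableM.
  exists (fun x => g x + f M x); split; first exact: bounded_measurableD.
  - by rewrite meanD// gm fm -natr1 mulrDl mul1r.
  - have -> : (fun x => (g x + f M x) * (g x + f M x)) =
        (fun x => (g x * g x + 2 * (g x * f M x)) + f M x * f M x).
      by apply/funext => x; ring.
    have b2 : bounded_measurable (fun x => 2 * (g x * f M x)).
      by apply: bounded_measurableM => //; exact: bounded_measurable_cst.
    have bgg : bounded_measurable (fun x => g x * g x).
      exact: bounded_measurableM.
    rewrite meanD//; last exact: bounded_measurableD.
    rewrite meanD// meanZ//.
    have := gM _ (leqnn M).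
    have : \int[mu]_x (f M x * f M x) <= 1.
      rewrite -[leRHS](mean_cst 1); apply: le_mean => //.
        exact: bounded_measurable_cst.
      by move=> x; have /andP[? ?] := f01 M x; nra.
    by rewrite -natr1; nra.
  - exists (maxn M M') => N; rewrite geq_max => /andP[MN M'N].
    under eq_Rintegral do rewrite mulrDl.
    rewrite meanD//; last exact: bounded_measurableM.
    by rewrite -natr1 mulrDl mul1r lerD ?gM ?fM'.
pose e := m ^+ 2 - c.
have e0 : 0 < e by rewrite subr_gt0.
have [k ke] : exists k : nat, e^-1 < k%:R.
  by exists (Num.Def.archi_bound e^-1); rewrite archi_boundP// invr_ge0 ltW.
have [g [bg gm gg _]] := P k.
have := mean_sqr_le bg; rewrite gm => kg.
have k0 : 0 < k%:R :> R by apply: lt_trans ke; rewrite invr_gt0.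
have : 1 < k%:R * e by rewrite -ltr_pdivrMr// mul1r.
by rewrite /e; nra.
Qed.

Lemma measurable_superlevel f (c : R) :
  measurable_fun [set: X] f -> measurable [set x | c <= f x].
Proof.
move=> mf.
have -> : [set x | c <= f x] = [set: X] `&` f @^-1` `[c, +oo[.
  by apply/seteqP; split => x /=; rewrite in_itv/= andbT //; case.
exact: mf.
Qed.

(** Since [f n <= c + \1_E] for [E] the superlevel set of [f n] at [c], a mean
    of at least [c + e] forces [mu E >= e]; and the measure of a limsup of sets
    is at least the limsup of their measures. *)
Lemma lim_sup_superlevel_gt0 (f : nat -> X -> R) (c e : R) :
  (forall n, measurable_fun [set: X] (f n)) ->
  (forall n x, 0 <= f n x <= 1) -> 0 <= c -> 0 < e ->
  (forall k, exists2 n, (k <= n)%N & c + e <= \int[mu]_x f n x) ->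
  (0 < mu (lim_sup_set (fun n => [set x | (c <= f n x)%R])))%E.
Proof.
move=> mf f01 c0 e0 fe; set E := (fun n => [set x | c <= f n x]).
have mE n : measurable (E n) by exact: measurable_superlevel.
have muE n : c + e <= \int[mu]_x f n x -> (e%:E <= mu (E n))%E.
  move=> cen; rewrite -[leRHS]fineK ?fin_num_measure// lee_fin -mean_indic//.
  have b1 : bounded_measurable (fun x => c + \1_(E n) x).
    by apply: bounded_measurableD;
      [exact: bounded_measurable_cst|exact: bounded_measurable_indic].
  have := le_mean (bounded_measurable_unit (mf n) (f01 n)) b1.
  rewrite meanD;
    [|exact: bounded_measurable_cst|exact: bounded_measurable_indic].
  rewrite mean_cst => /(_ _)/wrap[x|]; last lra.
  have /andP[? ?] := f01 n x.
  rewrite indicE; case: (boolP (x \in E n)) => /=; first lra.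
  by rewrite notin_setE /E /= => /negP; rewrite -ltNge; lra.
apply: (@lt_le_trans _ _ e%:E); first by rewrite lte_fin.
have cE : mu (\bigcup_(k >= n) E k) @[n --> \oo] --> mu (lim_sup_set E).
  apply: lim_sup_set_cvg => //; rewrite -ge0_fin_numE// fin_num_measure//.
  exact: bigcup_measurable.
rewrite -(cvg_lim _ cE)//; apply: lime_ge.
  by apply/cvg_ex; eexists; exact: cE.
apply: nearW => k; have [n kn /muE en] := fe k.
apply: (le_trans en); apply: le_measure; rewrite ?inE//.
  exact: bigcup_measurable.
by move=> x Ex; exists n.
Qed.

End BoundedMeasurable.

(** * Frequencies of membership in a finite family of sets *)

Section Frequency.
Local Set Implicit Arguments.
Local Unset Strict Implicit.
Context (R : realType) (d : measure_display) (X : measurableType d).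
Context (mu : probability X R) (K : choiceType).
Implicit Types (s : {fset K}) (A : K -> set X).

Definition frequency s A (x : X) : R :=
  (\sum_(k <- s) \1_(A k) x) / #|` s|%:R.

Lemma frequencyE s A x :
  frequency s A x = #|` [fset k in s | x \in A k]%fset|%:R / #|` s|%:R.
Proof.
congr (_ / _).
rewrite card_fset_sum1 -big_fset_condE/= natr_sum [RHS]big_mkcond/=.
by apply: eq_bigr => k _; rewrite indicE; case: (x \in A k).
Qed.

Lemma fset_ratio_le1 s (P : pred K) :
  #|` [fset k in s | P k]%fset|%:R / #|` s|%:R <= 1 :> R.
Proof.
have [->|s0] := eqVneq #|` s| 0%N; first by rewrite invr0 mulr0.
rewrite ler_pdivrMr ?ltr0n ?lt0n// mul1r ler_nat.
by apply: fsubset_leq_card; exact: fset_sub.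
Qed.

Lemma frequency_unit s A x : 0 <= frequency s A x <= 1.
Proof. by rewrite frequencyE divr_ge0//= fset_ratio_le1. Qed.

Lemma bounded_measurable_frequency s A : (forall k, measurable (A k)) ->
  bounded_measurable (frequency s A).
Proof.
move=> mA; apply: bounded_measurableM; last exact: bounded_measurable_cst.
by apply: bounded_measurable_sum => k; exact: bounded_measurable_indic.
Qed.

Lemma mean_mul_frequency s A (g : X -> R) : (forall k, measurable (A k)) ->
  bounded_measurable g ->
  \int[mu]_x (g x * frequency s A x) =
  (\sum_(k <- s) \int[mu]_x (g x * \1_(A k) x)) / #|` s|%:R.
Proof.
move=> mA bg.
have bgA k : bounded_measurable (fun x => g x * \1_(A k) x).
  by apply: bounded_measurableM => //; exact: bounded_measurable_indic.
rewrite -mean_sum// mulrC -meanZ; last exact: bounded_measurable_sum.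
by apply: eq_Rintegral => x _; rewrite /frequency -mulr_sumr; ring.
Qed.

Lemma mean_frequency s A : (forall k, measurable (A k)) ->
  \int[mu]_x frequency s A x = (\sum_(k <- s) fine (mu (A k))) / #|` s|%:R.
Proof.
move=> mA.
have := mean_mul_frequency s mA (@bounded_measurable_cst _ _ _ 1).
under eq_Rintegral do rewrite mul1r.
move=> ->; congr (_ / _); apply: eq_bigr => k _.
by under eq_Rintegral do rewrite mul1r; rewrite mean_indic.
Qed.

(** The function [frequency (F n) V] provided by [recurrent_correlation] is an
    average of finitely many indicators. If each of them correlated with
    [frequency (F N) V] by at most [c] for all large [N], so would it. *)
Lemma recurrent_intersection (F : nat -> {fset K}) (V : K -> set X) (m c : R) :
  (forall N, F N != fset0) -> (forall k, measurable (V k)) ->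
  (forall k, fine (mu (V k)) = m) -> 0 <= c -> c < m ^+ 2 ->
  exists k0, forall M, exists2 N, (M <= N)%N &
    c < \int[mu]_x frequency (F N) (fun k => V k0 `&` V k) x.
Proof.
move=> F0 mV Vm c0 cm.
have cardF N : 0 < #|` F N|%:R :> R by rewrite ltr0n cardfs_gt0.
have [n Hn] : exists n, forall k, exists2 N, (k <= N)%N &
    c < \int[mu]_x (frequency (F n) V x * frequency (F N) V x).
  apply: (@recurrent_correlation _ _ _ mu _ m) => // [N|N x|N].
  - by have [] := bounded_measurable_frequency (F N) mV.
  - exact: frequency_unit.
  - rewrite mean_frequency//; under eq_bigr do rewrite Vm.
    rewrite big_const_seq count_predT iter_addr_0 -[m *+ _]mulr_natr mulfK//.
    exact: lt0r_neq0.
apply: contrapT => /forallNP H.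
have {}H (k0 : F n) : \forall N \near \oo,
    \int[mu]_x frequency (F N) (fun k => V (val k0) `&` V k) x <= c.
  have /existsNP[M HM] := H (val k0); exists M => // N /= MN.
  by rewrite leNgt; apply/negP => cN; apply: HM; exists N.
have [M _ HM] := filter_forall _ H.
have [N MN] := Hn M; apply/negP; rewrite -leNgt.
under eq_Rintegral do rewrite mulrC.
rewrite mean_mul_frequency//; last exact: bounded_measurable_frequency.
rewrite ler_pdivrMr//.
apply: (@le_trans _ _ (\sum_(k <- F n) c)); last first.
  by rewrite big_const_seq count_predT iter_addr_0 mulr_natr.
rewrite big_seq [leRHS]big_seq; apply: ler_sum => k kF.
apply: le_trans (HM _ MN [` kF]%fset); rewrite le_eqVlt; apply/orP; left.
apply/eqP/eq_Rintegral => x _.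
rewrite /frequency mulrAC mulr_suml; congr (_ / _).
by apply: eq_bigr => k' _; rewrite indicI/= mulrC.
Qed.

End Frequency.

(** * Upper density and pairwise intersections *)

Section UpperDensity.
Local Set Implicit Arguments.
Local Unset Strict Implicit.
Context (R : realType) (d : measure_display) (X : measurableType d).
Context (mu : probability X R) (G : groupType) (F : nat -> {fset G}).

Lemma le_upper_density (c : R) (B : set G) :
  (forall k, exists2 N, (k <= N)%N &
    c <= #|` [fset g in F N | g \in B]%fset|%:R / #|` F N|%:R) ->
  c <= upper_density R F B.
Proof.
rewrite /upper_density; set u := (fun N : nat => _ : R) => cu.
have u1 N : `|u N| <= 1 by rewrite ger0_norm ?divr_ge0// fset_ratio_le1.
rewrite limn_supE; last first.
  by exists 1; split => // r r1 N _ /=; rewrite (le_trans (u1 N))// ltW.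
apply: lb_le_inf; first by exists (sups u 0%N); exists 0%N.
move=> _ [k _ <-]; have [N kN cuN] := cu k.
apply: (le_trans cuN); apply: ub_le_sup; last by exists N.
by exists 1 => _ [i _ <-]; rewrite (le_trans (ler_norm _)).
Qed.

(** Only countably many pairs of indices are involved, so the union of the null
    sets among their intersections is null. *)
Lemma ae_positive_intersections (A : G -> set X) :
  (forall g : G, measurable (A g)) ->
  {ae mu, forall x, forall N M (g g' : G), g \in F N -> g' \in F M ->
    A g x -> A g' x -> (0 < mu (A g `&` A g'))%E}.
Proof.
move=> mA.
have H N M (g : F N) (g' : F M) : {ae mu, forall x,
    A (val g) x -> A (val g') x -> (0 < mu (A (val g) `&` A (val g')))%E}.
  have [A0|A0] := eqVneq (mu (A (val g) `&` A (val g'))) 0%E; last first.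
    by apply/nearW => x _ _; rewrite lt0e A0 measure_ge0.
  exists (A (val g) `&` A (val g')); split => //; first exact: measurableI.
  by move=> x /= /not_implyP[Ag /not_implyP[Ag' _]].
have {}H : {ae mu, forall x, forall N M (g : F N) (g' : F M),
    A (val g) x -> A (val g') x -> (0 < mu (A (val g) `&` A (val g')))%E}.
  apply: ae_foralln => N; apply: ae_foralln => M.
  by apply: filter_forall => g; apply: filter_forall => g'; exact: H.
apply: filterS H => x H N M g g' gN gM.
exact: (H N M [` gN]%fset [` gM]%fset).
Qed.

(** The set [B] consists of the indices, in the union of the [F N], of the sets
    [A b] through one point [x] taken in the limsup of the superlevel sets of
    the frequencies and outside the null set of
    [ae_positive_intersections]. *)
Lemma dense_positive_intersections (A : G -> set X) (c e : R) :
  (forall g : G, measurable (A g)) -> 0 <= c -> 0 < e ->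
  (forall k, exists2 N, (k <= N)%N &
    c + e <= \int[mu]_x frequency R (F N) A x) ->
  exists2 B : set G, c <= upper_density R F B &
    forall b b', B b -> B b' -> (0 < mu (A b `&` A b'))%E.
Proof.
move=> mA c0 e0 Ae.
have mf N : measurable_fun [set: X] (frequency R (F N) A).
  by have [] := bounded_measurable_frequency R (F N) mA.
set E := lim_sup_set (fun N => [set x | c <= frequency R (F N) A x]).
have E0 : (0 < mu E)%E.
  by apply: lim_sup_superlevel_gt0 Ae => // N x; exact: frequency_unit.
have [x Ex Hx] : exists2 x, E x &
    forall N M (g g' : G), g \in F N -> g' \in F M ->
    A g x -> A g' x -> (0 < mu (A g `&` A g'))%E.
  apply: contrapT => noex.
  have : mu.-negligible E.
    apply: negligibleS (ae_positive_intersections mA) => x Ex /= Hx.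
    by apply: noex; exists x.
  move=> /measure_negligible mE0; move: E0; rewrite mE0 ?ltxx//.
  apply: bigcap_measurable => // k _; apply: bigcup_measurable => N _.
  exact: measurable_superlevel.
exists [set g | (exists N, g \in F N) /\ A g x]; last first.
  by move=> b b' [[N bN] Ab] [[M bM] Ab']; exact: Hx bN bM Ab Ab'.
apply: le_upper_density => k; have [N kN] := Ex k Logic.I.
rewrite /= frequencyE => cN; exists N => //; apply: (le_trans cN).
rewrite ler_wpM2r ?invr_ge0// ler_nat; apply: fsubset_leq_card.
apply/fsubsetP => g; rewrite !inE/= => /andP[gN /set_mem Agx].
by rewrite gN; apply/mem_set; split => //; exists N.
Qed.

End UpperDensity.

(** * Preimages of a set under a measure preserving action *)

Section Action.
Local Set Implicit Arguments.
Local Unset Strict Implicit.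
Context (R : realType) (d : measure_display) (X : measurableType d).
Context (mu : probability X R) (G : groupType) (T : G -> X -> X).
Context (hT : measure_preserving_system mu T).
Context (Y : set X) (mY : measurable Y).

Lemma action_image (g : G) : T g @` Y = T g^-1%g @^-1` Y.
Proof.
have [[T1 TM] _] := hT; apply/seteqP; split => [_ [x Yx <-]|x Yx] /=.
  have /(congr1 (@^~ x)) := TM g^-1%g g.
  by rewrite mulVg T1 /= => <-.
exists (T g^-1%g x) => //.
by have /(congr1 (@^~ x)) := TM g g^-1%g; rewrite mulgV T1 /= => <-.
Qed.

Lemma measurable_action_preimage (g : G) : measurable (T g @^-1` Y).
Proof.
have [_ /(_ g)[mT _]] := hT.
by rewrite -[X in measurable X]setTI; exact: mT.
Qed.

Lemma measure_action_preimage (g : G) : mu (T g @^-1` Y) = mu Y.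
Proof. by have [_ /(_ g)[_ ->]] := hT. Qed.

Lemma measure_preimageI_mulr (a b g : G) :
  mu (T (a * g)%g @^-1` Y `&` T (b * g)%g @^-1` Y) =
  mu (T a @^-1` Y `&` T b @^-1` Y).
Proof.
have [[_ TM] /(_ g)[_ muT]] := hT; rewrite !TM.
by rewrite -[RHS]muT//; apply: measurableI; exact: measurable_action_preimage.
Qed.

(** Right multiplication by [b], and then by [(a * b)^-1], carries the pair
    [(a, b^-1)] to [(a * b, 1)] and to [(1, (a * b)^-1)]. *)
Lemma positive_return_preimage (a b : G) :
  (0 < mu (T a @^-1` Y `&` T b^-1%g @^-1` Y))%E ->
  positive_return_set mu T Y (a * b)%g.
Proof.
rewrite /positive_return_set /= action_image.
rewrite -(measure_preimageI_mulr a b^-1%g b) mulVg.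
rewrite -(measure_preimageI_mulr (a * b)%g 1%g (a * b)^-1%g) mulgV mul1g.
by have [[-> _] _] := hT.
Qed.

End Action.

(** * Return times in [h^2 B B] *)

Theorem theorem1p37 (G : groupType) (F : nat -> {fset G})
    (hF : forall N : nat, F N != fset0)
    (R : realType) (d : measure_display) (X : measurableType d)
    (mu : probability X R) (T : G -> X -> X)
    (hT : measure_preserving_system mu T)
    (Y : set X) (mY : measurable Y) (eps : R) (heps : 0 < eps) :
  exists (h : G) (B : set G),
    fine (mu Y) ^+ 2 - eps <= upper_density R F B /\
    sq_shift_product h B `<=` positive_return_set mu T Y.
Proof.
set m := fine (mu Y).
have [c0|c0] := leP 0 (m ^+ 2 - eps); last first.
  exists 1%g, set0; split; last by move=> _ [b []].
  apply: le_upper_density => k; exists k => //.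
  by apply: (le_trans (ltW c0)); rewrite divr_ge0.
have mT g : measurable (T g @^-1` Y) := measurable_action_preimage hT mY g.
pose V b := T (b^-1 * b^-1)%g @^-1` Y.
have mV b : measurable (V b) by exact: mT.
(* Half of [eps] is kept for the passage from means to points. *)
have [b0 Hb0] : exists b0, forall M, exists2 N, (M <= N)%N &
    m ^+ 2 - eps / 2 <
    \int[mu]_x frequency R (F N) (fun b => V b0 `&` V b) x.
  apply: (@recurrent_intersection _ _ _ _ _ _ _ m) => //.
  - by move=> b; rewrite /m -(measure_action_preimage hT mY (b^-1 * b^-1)%g).
  - by lra.
  - by lra.
pose h := (b0^-1)%g.
pose A b := T (h ^+ 2 * b)%g @^-1` Y `&` T b^-1%g @^-1` Y.
have mA b : measurable (A b) by apply: measurableI; exact: mT.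
have AV b : mu (A b) = mu (V b0 `&` V b).
  by rewrite /A -(measure_preimageI_mulr hT mY _ _ b^-1%g) mulgK expg2.
have e2 : 0 < eps / 2 by rewrite divr_gt0.
have [|B cB HB] := dense_positive_intersections mA c0 e2 (mu := mu) (F := F).
  move=> k; have [N kN cN] := Hb0 k; exists N => //.
  rewrite mean_frequency//; under eq_bigr do rewrite AV.
  rewrite -mean_frequency; last by move=> b; exact: measurableI.
  by apply: le_trans (ltW cN); lra.
exists h, B; split => // _ [b Bb] [b' Bb'] <-.
apply: positive_return_preimage => //.
apply: (lt_le_trans (HB _ _ Bb Bb')); apply: le_measure; rewrite ?inE.
- exact: measurableI.
- by apply: measurableI; exact: mT.
- by move=> x [[? _] [_ ?]].
Qed.
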